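(* Let $G$ be an abelian group. Then $G$ is generalized-cyclic-diamond free if and only if every finitely generated subgroup $H\leq G$ is cyclic or isomorphic to $\mathbb{Z}\times\mathbb{Z}_{2^N}$ for some $N\in\mathbb{N}$.
   Context: $\langle x\rangle$ denotes the subgroup generated by $x$, and $\mathbb{Z}_n$ is the cyclic group of order $n$. In the lattice of subgroups of a group, the meet $A\wedge B$ is $A\cap B$ and the join $A\vee B$ is the subgroup generated by $A\cup B$. A diamond (a sublattice isomorphic to $M_3$) with top $T$, middle elements $A,B,C$ and bottom $D$ consists of five pairwise distinct subgroups such that $A\vee B=A\vee C=B\vee C=T$ and $A\wedge B=A\wedge C=B\wedge C=D$. A generalized-cyclic-diamond in $G$ is a diamond in the subgroup lattice of $G$ with top some subgroup $H\leq G$, middle elements $\langle x\rangle,\langle y\rangle,\langle z\rangle$ and bottom $\langle a\rangle$, for elements $x,y,z,a\in G$ (the top need not be cyclic, and there is no maximality condition on $\langle a\rangle$). $G$ is generalized-cyclic-diamond free if its subgroup lattice contains no generalized-cyclic-diamond. *)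

(* Defs.v *)
From mathcomp Require Import all_boot all_order all_algebra.
From mathcomp Require Import all_classical.

Set Implicit Arguments.
Unset Strict Implicit.
Unset Printing Implicit Defensive.

Import GRing.Theory.
Local Open Scope classical_set_scope.
Local Open Scope ring_scope.

Definition subgroup (G : zmodType) (A : set G) : Prop :=
  zmod_closed (mem A).

Definition gen (G : zmodType) (A : set G) : set G :=
  smallest (@subgroup G) A.

Definition cyc (G : zmodType) (x : G) : set G := gen [set x].

Definition join (G : zmodType) (A B : set G) : set G := gen (A `|` B).

Definition finitely_generated (G : zmodType) (H : set G) : Prop :=
  exists2 X : set G, finite_set X & H = gen X.

Definition cyclic_subgroup (G : zmodType) (H : set G) : Prop :=
  exists x : G, H = cyc x.

(* H is isomorphic to V: f is an isomorphism V -> H composed with the inclusion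
   of H in G. *)
Definition isomorphic (G V : zmodType) (H : set G) : Prop :=
  exists2 f : {additive V -> G}, injective f & range f = H.

(* The cyclic group of order n for n > 0.  We avoid 'Z_n, which has order 2
   when n = 1. *)
Notation Zmod n := ('I_(n.-1.+1)).

Definition diamond (G : zmodType) (T A B C D : set G) : Prop :=
  [/\ [/\ subgroup T, subgroup A, subgroup B, subgroup C & subgroup D],
      uniq [:: T; A; B; C; D],
      [/\ join A B = T, join A C = T & join B C = T] &
      [/\ A `&` B = D, A `&` C = D & B `&` C = D]].

Definition generalized_cyclic_diamond_free (G : zmodType) : Prop :=
  ~ exists (H : set G) (x y z a : G),
      diamond H (cyc x) (cyc y) (cyc z) (cyc a).

(* Main.v *)
Require Import Defs.
From HB Require Import structures.
From mathcomp Require Import all_boot all_order all_algebra.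
From mathcomp Require Import all_classical.
From mathcomp Require Import zify ring.

Set Implicit Arguments.
Unset Strict Implicit.
Unset Printing Implicit Defensive.

Import GRing.Theory.
Local Open Scope classical_set_scope.
Local Open Scope ring_scope.

(** Let T be the top of a diamond with cyclic middle A, B, C and bottom D.
Then T/D is the direct sum of any two of A/D, B/D, C/D.  Thus T is generated
by two elements, and T/D is the square of a cyclic group.

If every finitely generated subgroup is cyclic or of the form Z x Z_(2^N),
this applies to T.  An integer that sends one of A, B, C into D sends all of T
into D ([diamond_mulrz]), because A/D, B/D and C/D are isomorphic.  If T is
cyclic, two generators x = m g and y = n g satisfy n x = m y, which lies in D;
so n and m both send T into D, hence so does 1, and T = D
([no_cyclic_diamond_top]).  If T = Z x Z_(2^N), the same computation shows
that 2^N sends T into D, so N > 0, and the generators of A, B, C map to three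
nonzero vectors of T/2T = F_2^2, pairwise distinct because any two of them
generate.  One of them is therefore (0, 1).  But the multiple by 2^N of
another generator lies in D, thus is a multiple of the generator over (0, 1),
which forces the even first coordinate of the latter to be a unit of Z
([no_split_diamond_top]).

Conversely, three configurations yield diamonds: Z x Z and Z_p x Z_p, with
middle <v>, <w>, <v + w> and bottom 0 ([not_free_disjoint],
[not_free_elementary]); and Z x Z_p for an odd prime p, with middle <x>,
<x + t>, <x + 2t> and bottom <p x> ([not_free_infinite_odd]), where p must be
odd for <x> and <x + 2t> to generate t.  Assume that G has none of these, and
let K be generated by two elements.  They satisfy a nontrivial relation, and a
relation of content d becomes d t = 0 for a suitable second generator t of K.
Take d minimal among all pairs of generators of K ([reduced_basis]).  If d = 1
then K is cyclic.  If d > 1 and the first generator has finite order o, then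
d divides o, and a prime divisor of d gives a Z_p x Z_p in K.  Otherwise K is
the direct sum of Z and Z_d, and an odd prime divisor of d would give a
Z x Z_p ([two_generated_of_free]).  Finally every finitely generated subgroup
has two generators: the second one can be kept torsion, and two torsion
elements generate a cyclic group, so a new generator can always be absorbed
([finitely_generated_of_free]). *)

(** * Subgroups generated by two elements *)

Lemma subgroupP (G : zmodType) (A : set G) :
  subgroup A <-> A 0 /\ forall x y, A x -> A y -> A (x - y).
Proof.
split=> [[A0 AB]|[A0 AB]].
  by split=> [|x y Ax Ay]; apply/set_mem; [exact: A0|apply: AB; exact: mem_set].
by split=> [|x y /set_mem Ax /set_mem Ay]; apply: mem_set; [|exact: AB].
Qed.

Lemma subgroupD (G : zmodType) (A : set G) (x y : G) :
  subgroup A -> A x -> A y -> A (x + y).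
Proof.
case/subgroupP=> A0 AB Ax Ay; rewrite -[y]opprK; apply: (AB) => //.
by rewrite -[- y]add0r; apply: AB.
Qed.

Lemma subgroup_mulrz (G : zmodType) (A : set G) (x : G) (m : int) :
  subgroup A -> A x -> A (x *~ m).
Proof.
move=> sA Ax; have [A0 AB] := (subgroupP A).1 sA.
have An n : A (x *+ n).
  by elim: n => [|n IHn]; rewrite ?mulr0n ?mulrS//; apply: subgroupD.
case: m => n; first exact: An.
by rewrite NegzE mulrNz -[- _]add0r; apply: AB => //; apply: An.
Qed.

Lemma gen_subgroup (G : zmodType) (A : set G) : subgroup (gen A).
Proof.
apply/subgroupP; split=> [B [sB _]|x y Ax Ay B [sB AB]].
  by case/subgroupP: sB.
have [_ BB] := (subgroupP B).1 sB.
by apply: BB; [apply: Ax|apply: Ay].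
Qed.

Lemma sub_gen (G : zmodType) (A : set G) : A `<=` gen A.
Proof. exact: sub_gen_smallest. Qed.

Lemma gen_min (G : zmodType) (A B : set G) :
  subgroup B -> A `<=` B -> gen A `<=` B.
Proof. exact: smallest_sub. Qed.

Lemma gen_setU_gen (G : zmodType) (A B : set G) :
  gen (A `|` gen B) = gen (A `|` B).
Proof.
apply/seteqP; split; apply: gen_min; try exact: gen_subgroup.
  move=> x [Ax|]; first by apply: sub_gen; left.
  apply: gen_min; first exact: gen_subgroup.
  by move=> y By; apply: sub_gen; right.
move=> x [Ax|Bx]; apply: sub_gen; first by left.
by right; apply: sub_gen.
Qed.

Lemma joinC (G : zmodType) (A B : set G) : join A B = join B A.
Proof. by rewrite /join setUC. Qed.

Lemma joinA (G : zmodType) (A B C : set G) :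
  join A (join B C) = join (join A B) C.
Proof.
by rewrite [in RHS]joinC /join !gen_setU_gen setUA [in RHS]setUC.
Qed.

Lemma join_min (G : zmodType) (A B C : set G) :
  subgroup C -> A `<=` C -> B `<=` C -> join A B `<=` C.
Proof. by move=> sC AC BC; apply: gen_min => // x [/AC|/BC]. Qed.

Lemma sub_joinl (G : zmodType) (A B : set G) : A `<=` join A B.
Proof. by move=> x Ax; apply: sub_gen; left. Qed.

Lemma sub_joinr (G : zmodType) (A B : set G) : B `<=` join A B.
Proof. by move=> x Ax; apply: sub_gen; right. Qed.

Definition comb (G : zmodType) (x y : G) (m n : int) : G := x *~ m + y *~ n.

Lemma combB (G : zmodType) (x y : G) (m n k l : int) :
  comb x y m n - comb x y k l = comb x y (m - k) (n - l).
Proof. by rewrite /comb !mulrzBr opprD addrACA. Qed.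

Lemma combD (G : zmodType) (x y : G) (m n k l : int) :
  comb x y m n + comb x y k l = comb x y (m + k) (n + l).
Proof.
have -> : comb x y k l = - comb x y (- k) (- l).
  by rewrite /comb !mulrNz -opprD opprK.
by rewrite combB !opprK.
Qed.

Lemma combM (G : zmodType) (x y : G) (m n k : int) :
  comb x y m n *~ k = comb x y (m * k) (n * k).
Proof. by rewrite /comb -[k]intz mulrzDl_tmp -!mulrzA. Qed.

Lemma comb_comb (G : zmodType) (x y : G) (a b c d m n : int) :
  comb (comb x y a b) (comb x y c d) m n
  = comb x y (a * m + c * n) (b * m + d * n).
Proof. by rewrite {1}/comb !combM combD. Qed.

Lemma comb10 (G : zmodType) (x y : G) : comb x y 1 0 = x.
Proof. by rewrite /comb mulr1z mulr0z addr0. Qed.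

Lemma comb01 (G : zmodType) (x y : G) : comb x y 0 1 = y.
Proof. by rewrite /comb mulr1z mulr0z add0r. Qed.

Lemma cyc_id (G : zmodType) (x : G) : cyc x x.
Proof. exact: sub_gen. Qed.

Lemma cyc_min (G : zmodType) (A : set G) (x : G) :
  subgroup A -> A x -> cyc x `<=` A.
Proof. by move=> sA Ax; apply: gen_min => // y ->. Qed.

Lemma cycP (G : zmodType) (x w : G) : cyc x w <-> exists m : int, w = x *~ m.
Proof.
split=> [|[m ->]]; last first.
  by apply: (@subgroup_mulrz _ (cyc x)); [exact: gen_subgroup|exact: cyc_id].
apply: (@cyc_min _ [set w | exists m : int, w = x *~ m]) => //=.
  apply/subgroupP; split; first by exists 0; rewrite mulr0z.
  by move=> _ _ [m ->] [n ->]; exists (m - n); rewrite mulrzBr.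
by exists 1; rewrite mulr1z.
Qed.

Lemma join_cycP (G : zmodType) (x y w : G) :
  join (cyc x) (cyc y) w <-> exists m n : int, w = comb x y m n.
Proof.
split=> [|[m [n ->]]].
  apply: (@join_min _ _ _ [set w | exists m n : int, w = comb x y m n]) => /=.
  - apply/subgroupP; split; first by exists 0, 0; rewrite /comb !mulr0z addr0.
    by move=> _ _ [m [n ->]] [k [l ->]]; exists (m - k), (n - l); rewrite combB.
  - by move=> _ /cycP[m ->]; exists m, 0; rewrite /comb mulr0z addr0.
  - by move=> _ /cycP[m ->]; exists 0, m; rewrite /comb mulr0z add0r.
apply: (@subgroupD _ (join _ _)); first exact: gen_subgroup.
  by apply: (@sub_joinl _ (cyc x)); apply/cycP; exists m.
by apply: (@sub_joinr _ _ (cyc y)); apply/cycP; exists n.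
Qed.

Lemma cyc0 (G : zmodType) : cyc (0 : G) = [set 0].
Proof.
apply/seteqP; split=> [_ /cycP[m ->]|_ ->]; last exact: cyc_id.
by rewrite mul0rz.
Qed.

(** * Configurations that produce a diamond *)

(** Only containments are asked for: equality of the joins and of the meets
follows, and so does the distinctness of the five subgroups, since any
coincidence would put x, y or z in another middle subgroup or in D, hence in D. *)
Lemma diamond_of_generators (G : zmodType) (x y z a : G) :
  cyc x a -> cyc y a -> cyc z a ->
  cyc x `&` cyc y `<=` cyc a -> cyc x `&` cyc z `<=` cyc a ->
  cyc y `&` cyc z `<=` cyc a ->
  join (cyc y) (cyc z) x -> join (cyc x) (cyc z) y ->
  join (cyc x) (cyc y) z ->
  ~ cyc a x -> ~ cyc a y -> ~ cyc a z ->
  ~ generalized_cyclic_diamond_free G.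
Proof.
move=> xa ya za xy xz yz jx jy jz ax ay az; apply.
have sg (u : G) : subgroup (cyc u) by apply: gen_subgroup.
have sj (A B : set G) : subgroup (join A B) by apply: gen_subgroup.
exists (join (cyc x) (cyc y)), x, y, z, a.
have jxz : join (cyc x) (cyc z) = join (cyc x) (cyc y).
  apply/seteqP; split; apply: join_min => //; try exact: sub_joinl.
    exact: cyc_min.
  exact: cyc_min.
have jyz : join (cyc y) (cyc z) = join (cyc x) (cyc y).
  apply/seteqP; split; apply: join_min => //; try exact: sub_joinl.
  - exact: sub_joinr.
  - exact: cyc_min.
  - exact: cyc_min.
have Ixy : cyc x `&` cyc y = cyc a.
  by apply/seteqP; split => // w /[dup] /(cyc_min (sg x) xa)? /(cyc_min (sg y) ya).
have Ixz : cyc x `&` cyc z = cyc a.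
  by apply/seteqP; split => // w /[dup] /(cyc_min (sg x) xa)? /(cyc_min (sg z) za).
have Iyz : cyc y `&` cyc z = cyc a.
  by apply/seteqP; split => // w /[dup] /(cyc_min (sg y) ya)? /(cyc_min (sg z) za).
have Tx : join (cyc x) (cyc y) x by apply: (@sub_joinl _ (cyc x)); exact: cyc_id.
have Ty : join (cyc x) (cyc y) y by apply: (@sub_joinr _ _ (cyc y)); exact: cyc_id.
split=> //.
have nxy : cyc x y -> False by move=> h; apply: ay; apply: xy; split=> //; apply: cyc_id.
have nyx : cyc y x -> False by move=> h; apply: ax; apply: xy; split=> //; apply: cyc_id.
have nzx : cyc z x -> False by move=> h; apply: ax; apply: xz; split=> //; apply: cyc_id.
have nzy : cyc z y -> False by move=> h; apply: ay; apply: yz; split=> //; apply: cyc_id.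
have neq (A B : set G) w : A w -> (B w -> False) -> ~~ pselect (A = B).
  by move=> Aw nB; case: pselect => //= AB; case: nB; rewrite -AB.
rewrite /= !inE !negb_or !andbT.
have x1 : cyc x x by exact: cyc_id.
have y1 : cyc y y by exact: cyc_id.
have z1 : cyc z z by exact: cyc_id.
rewrite (neq _ _ _ Ty nxy) (neq _ _ _ Tx nyx) (neq _ _ _ Tx nzx).
rewrite (neq _ _ _ Tx ax) (neq _ _ _ x1 nyx) (neq _ _ _ x1 nzx).
by rewrite (neq _ _ _ x1 ax) (neq _ _ _ y1 nzy) (neq _ _ _ y1 ay) (neq _ _ _ z1 az).
Qed.

Lemma mulrz_dvd (G : zmodType) (x : G) (d m : int) :
  x *~ d = 0 -> (d %| m)%Z -> x *~ m = 0.
Proof. by move=> xd /dvdzP[q ->]; rewrite mulrC mulrzA xd mul0rz. Qed.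

Lemma mulrz_lin (G : zmodType) (x : G) (u v m n : int) :
  x *~ (u * m + v * n) = x *~ m *~ u + x *~ n *~ v.
Proof. by rewrite mulrzDr_tmp [u * m]mulrC [v * n]mulrC !mulrzA. Qed.

Lemma coprimez_prime (p : nat) (i : int) :
  prime p -> (p %| i)%Z \/ exists u v : int, u * p%:Z + v * i = 1.
Proof.
move=> pp; have [|ndvd] := boolP (p %| i)%Z; [by left|right].
have [u [v]] := Bezoutz p i; rewrite /gcdz absz_nat => e.
exists u, v; rewrite e; congr Posz; apply/eqP.
by rewrite -/(coprime p `|i|) prime_coprime.
Qed.

Lemma prime_order (G : zmodType) (p : nat) (v : G) (i : int) :
  prime p -> v *~ p = 0 -> v <> 0 -> v *~ i = 0 -> (p %| i)%Z.
Proof.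
move=> pp vp v0 vi; have [//|[u [w e]]] := coprimez_prime i pp.
by case: v0; rewrite -[v]mulr1z -e mulrz_lin vp vi !mul0rz addr0.
Qed.

(** The hypothesis on relations says that <v> and <w> meet trivially and that
v and w have the same order (possibly infinite), which is what makes <v + w>
meet <v> and <w> trivially. *)
Lemma not_free_disjoint (G : zmodType) (v w : G) :
  v <> 0 -> w <> 0 ->
  (forall i j : int, comb v w i j = 0 ->
     [/\ v *~ i = 0, v *~ j = 0, w *~ i = 0 & w *~ j = 0]) ->
  ~ generalized_cyclic_diamond_free G.
Proof.
move=> v0 w0 H.
have c0 u : cyc u (0 : G) by apply/cycP; exists 0; rewrite mulr0z.
have vw : v + w = comb v w 1 1 by rewrite /comb !mulr1z.
have subr_comb i j k l : comb v w i j = comb v w k l ->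
  [/\ v *~ (i - k) = 0, v *~ (j - l) = 0, w *~ (i - k) = 0 & w *~ (j - l) = 0].
  by move=> e; apply: H; rewrite -combB e subrr.
have cv i : v *~ i = comb v w i 0 by rewrite /comb mulr0z addr0.
have cw i : w *~ i = comb v w 0 i by rewrite /comb mulr0z add0r.
apply: (@diamond_of_generators G v w (v + w) 0) => //.
- move=> _ [/cycP[i ->] /cycP[j]]; rewrite cyc0 /= cv cw => /subr_comb[].
  by rewrite subr0 -cv.
- move=> _ [/cycP[i ->] /cycP[j]]; rewrite cyc0 /= vw combM !mul1r cv.
  move=> /subr_comb[vi vj _ _]; rewrite -cv -[i](subrK j) mulrzDr_tmp vi.
  by rewrite add0r -[j]opprK mulrNz -[- j]sub0r vj oppr0.
- move=> _ [/cycP[i ->] /cycP[j]]; rewrite cyc0 /= vw combM !mul1r cw.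
  move=> /subr_comb[_ _ wj wi]; rewrite -cw -[i](subrK j) mulrzDr_tmp wi.
  by rewrite add0r -[j]opprK mulrNz -[- j]sub0r wj oppr0.
- apply/join_cycP; exists (-1), 1.
  by rewrite /comb mulrN1z mulr1z [v + w]addrC addKr.
- by apply/join_cycP; exists (-1), 1; rewrite /comb mulrN1z mulr1z addKr.
- by apply/join_cycP; exists 1, 1.
- by rewrite cyc0.
- by rewrite cyc0.
- rewrite cyc0 /= vw => e; apply: v0.
  by have [] := H 1 1 e; rewrite mulr1z.
Qed.

Lemma not_free_elementary (G : zmodType) (p : nat) (v w : G) :
  prime p -> v *~ p = 0 -> w *~ p = 0 -> v <> 0 -> ~ cyc v w ->
  ~ generalized_cyclic_diamond_free G.
Proof.
move=> pp vp wp v0 vw; apply: (@not_free_disjoint G v w) => //.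
  by move=> w0; apply: vw; apply/cycP; exists 0; rewrite mulr0z.
move=> i j e; have pj : (p %| j)%Z.
  have [//|[a [b ab]]] := coprimez_prime j pp.
  case: vw; apply/cycP; exists (- i * b).
  rewrite -[w]mulr1z -ab mulrz_lin wp mul0rz add0r mulrzA mulrNz.
  by congr (_ *~ _); apply/eqP; rewrite -addr_eq0 addrC; apply/eqP.
have pi : (p %| i)%Z.
  apply: (@prime_order _ _ v) => //.
  by rewrite -e /comb (mulrz_dvd wp pj) addr0.
by split; apply: mulrz_dvd; eassumption.
Qed.

Lemma not_free_infinite_odd (G : zmodType) (p : nat) (x t : G) :
  prime p -> odd p -> (forall m : int, x *~ m = 0 -> m = 0) ->
  t *~ p = 0 -> t <> 0 -> ~ generalized_cyclic_diamond_free G.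
Proof.
move=> pp op xinf tp t0.
have rel m n : comb x t m n = 0 -> m = 0 /\ (p %| n)%Z.
  move=> e; have m0 : m = 0.
    have /xinf/eqP : x *~ (m * p%:Z) = 0.
      have := congr1 (fun z => z *~ p) e.
      by rewrite combM /comb mul0rz [n * _]mulrC [t *~ _]mulrzA tp mul0rz addr0.
    by rewrite mulf_eq0 => /orP[/eqP//|/eqP[p0]]; rewrite p0 in pp.
  split=> //; apply: prime_order t0 _ => //.
  by rewrite -e m0 /comb mulr0z add0r.
have eqc m n k l : comb x t m n = comb x t k l -> m = k /\ (p %| n - l)%Z.
  move=> e; have [|/eqP] := rel (m - k) (n - l); first by rewrite -combB e subrr.
  by rewrite subr_eq0 => /eqP.
pose s c := comb x t 1 c; pose a := x *~ p.
have sM c m : s c *~ m = comb x t m (c * m) by rewrite combM mul1r.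
have aE m n : (p %| m)%Z -> (p %| n)%Z -> cyc a (comb x t m n).
  move=> /dvdzP[q ->] pn; apply/cycP; exists q.
  by rewrite /comb (mulrz_dvd tp pn) addr0 mulrC mulrzA.
have sa c : cyc (s c) a.
  apply/cycP; exists p; rewrite sM /comb [t *~ _](mulrz_dvd tp) ?addr0//.
  exact: dvdz_mull.
have as_ c : ~ cyc a (s c).
  move=> /cycP[m]; rewrite /a -mulrzA.
  have -> : x *~ (p%:Z * m) = comb x t (p%:Z * m) 0 by rewrite /comb mulr0z addr0.
  move=> /eqc[e _]; have : (p %| (1 : int)%R)%Z by rewrite e dvdz_mulr.
  by rewrite dvdzE /= dvdn1 => /eqP p1; rewrite p1 in pp.
have meet c c' : ~~ (p %| c - c')%Z -> cyc (s c) `&` cyc (s c') `<=` cyc a.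
  move=> ndvd _ [/cycP[i ->] /cycP[j]]; rewrite !sM => /eqc[<-].
  rewrite -mulrBl => pdvd; have pi : (p %| i)%Z.
    have := pdvd; rewrite Gauss_dvdzr // /coprimez /gcdz.
    by rewrite -[_ == 1]/(coprime `|_| `|_|) prime_coprime.
  by apply: aE => //; exact: dvdz_mull.
have ndvd (c : nat) : (0 < c < 3)%N -> ~~ (p %| c)%N.
  case: c => [|[|[|//]]] // _; first by rewrite dvdn1; case: p pp op {a sa as_ aE meet eqc rel tp} => [|[]].
  by rewrite dvdn_prime2 //; apply/negP => /eqP p2; rewrite p2 in op.
(* The three meets are contained in <p x> because 1 and 2 are prime to p; the
   witness (p + 1) / 2 below is the inverse of 2 mod p. *)
apply: (@diamond_of_generators G (s 0) (s 1) (s 2) a) => //.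
- by apply: meet; rewrite dvdzE; exact: (ndvd 1).
- by apply: meet; rewrite dvdzE; exact: (ndvd 2).
- by apply: meet; rewrite dvdzE; exact: (ndvd 1).
- by apply/join_cycP; exists 2, (-1); rewrite comb_comb; congr comb; ring.
- apply/join_cycP; exists (1 - p.+1./2%:Z), (p.+1./2%:Z); rewrite comb_comb /s.
  have -> : 1 * (1 - p.+1./2%:Z) + 1 * p.+1./2%:Z = 1 by ring.
  have -> : 0 * (1 - p.+1./2%:Z) + 2 * p.+1./2%:Z = p%:Z + 1 by lia.
  by rewrite /comb mulrzDr_tmp tp add0r.
- by apply/join_cycP; exists (-1), 2; rewrite comb_comb; congr comb; ring.
Qed.

Lemma join_cyc_eq (G : zmodType) (x y x' y' : G) :
  join (cyc x) (cyc y) x' -> join (cyc x) (cyc y) y' ->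
  join (cyc x') (cyc y') x -> join (cyc x') (cyc y') y ->
  join (cyc x') (cyc y') = join (cyc x) (cyc y).
Proof.
have sj (A B : set G) : subgroup (join A B) by apply: gen_subgroup.
by move=> hx' hy' hx hy; apply/seteqP; split; apply: join_min => //; apply: cyc_min.
Qed.

(** * Two-generated subgroups *)

(** After division by their gcd, the coefficients of the relation form a
primitive vector; a Bezout relation completes it to a unimodular matrix, which
gives the new pair of generators. *)
Lemma relation_basis (G : zmodType) (x y : G) (m n : int) :
  (m, n) != (0, 0) -> comb x y m n = 0 ->
  exists x' t : G, join (cyc x') (cyc t) = join (cyc x) (cyc y) /\
    t *~ gcdz m n = 0.
Proof.
move=> mn0 e; set g := gcdz m n.
have g0 : g != 0.
  by apply: contra mn0; rewrite /g gcdz_eq0 => /andP[/eqP-> /eqP->].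
have /dvdzP[m' em] : (g %| m)%Z by exact: dvdz_gcdl.
have /dvdzP[n' en] : (g %| n)%Z by exact: dvdz_gcdr.
have [u [v uv]] := Bezoutz m n.
have uv1 : u * m' + v * n' = 1.
  apply: (mulIf g0); rewrite mul1r; transitivity (u * m + v * n); last exact: uv.
  by rewrite [in RHS]em [in RHS]en; ring.
exists (comb x y (- v) u), (comb x y m' n'); split; last first.
  by rewrite combM -em -en.
apply: join_cyc_eq.
- by apply/join_cycP; eexists; eexists.
- by apply/join_cycP; eexists; eexists.
- apply/join_cycP; exists (- n'), u; rewrite comb_comb -[LHS](comb10 x y).
  by congr comb; [rewrite -uv1|]; ring.
- apply/join_cycP; exists m', v; rewrite comb_comb -[LHS](comb01 x y).
  by congr comb; [|rewrite -uv1]; ring.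
Qed.

(** The minimum is taken over all pairs of generators of the subgroup and not
only over the relations of one pair: by [relation_basis], every relation of
the chosen pair yields a competitor, so that its content is at least d. *)
Lemma reduced_basis (G : zmodType) (x y : G) (m n : int) :
  (m, n) != (0, 0) -> comb x y m n = 0 ->
  exists (x' t : G) (d : nat),
    [/\ join (cyc x') (cyc t) = join (cyc x) (cyc y), (0 < d)%N, t *~ d = 0 &
      forall k l : int, (k, l) != (0, 0) -> comb x' t k l = 0 ->
        (d <= `|gcdz k l|)%N].
Proof.
move=> mn0 e.
pose P (d : nat) := `[< (0 < d)%N /\ exists x' t : G,
  join (cyc x') (cyc t) = join (cyc x) (cyc y) /\ t *~ d = 0 >].
have gP (x1 y1 : G) (k l : int) : (k, l) != (0, 0) -> comb x1 y1 k l = 0 ->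
    join (cyc x1) (cyc y1) = join (cyc x) (cyc y) -> P `|gcdz k l|%N.
  move=> kl0 e1 j1; have [x' [t [jt tg]]] := relation_basis kl0 e1.
  apply/asboolP; split.
    rewrite absz_gt0 gcdz_eq0; apply: contra kl0.
    by move=> /andP[/eqP-> /eqP->].
  by exists x', t; rewrite jt.
have exP : exists d, P d by eexists; apply: gP mn0 e _.
case: (ex_minnP exP) => d /asboolP[d0 [x' [t [jt td]]]] dmin.
exists x', t, d; split=> // k l kl0 ekl.
by apply: dmin; apply: gP kl0 ekl jt.
Qed.

Lemma mulrz_gcdz (G : zmodType) (x : G) (m n : int) :
  x *~ m = 0 -> x *~ n = 0 -> x *~ gcdz m n = 0.
Proof.
move=> xm xn; have [u [v <-]] := Bezoutz m n.
by rewrite mulrz_lin xm xn !mul0rz addr0.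
Qed.

Lemma dvdn_of_leq_gcd (d n : nat) : (0 < d)%N -> (d <= gcdn n d)%N -> (d %| n)%N.
Proof.
move=> d0 le_dg; suff -> : d = gcdn n d by exact: dvdn_gcdl.
by apply/eqP; rewrite eqn_leq le_dg dvdn_leq // dvdn_gcdr.
Qed.

Lemma exists_order (G : zmodType) (x : G) (m : int) :
  m != 0 -> x *~ m = 0 ->
  exists2 o : nat, (0 < o)%N & x *~ o = 0 /\ forall k : int, x *~ k = 0 -> (o %| k)%Z.
Proof.
move=> m0 xm.
pose P (o : nat) := (0 < o)%N && (x *~ o == 0).
have exP : exists o, P o.
  exists `|m|%N; rewrite /P absz_gt0 m0 /=; apply/eqP.
  by apply: mulrz_dvd xm _; rewrite dvdzE.
case: (ex_minnP exP) => o /andP[o0 /eqP xo] omin; exists o => //; split=> // k xk.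
have le_og : (o <= `|gcdz k o|)%N.
  apply: omin; rewrite /P absz_gt0 gcdz_eq0 negb_and orbC -absz_gt0 o0 /=.
  by apply/eqP/mulrz_dvd; [exact: mulrz_gcdz xk xo|rewrite dvdzE].
by rewrite dvdzE; exact: dvdn_of_leq_gcd.
Qed.

(** The decomposition of <e, t> as Z x Z_d, with e and t as the standard
generators, in terms of relations: this is the form in which two-generated
subgroups are analysed, and it avoids residues modulo d. *)
Definition split_basis (G : zmodType) (e t : G) (d : nat) : Prop :=
  forall m n : int, comb e t m n = 0 <-> m = 0 /\ (d %| n)%Z.

(** The subgroup is cyclic if the minimal content d of a relation is 1; for
d > 1, minimality turns a finite order of the first generator, or an odd prime
divisor of d, into one of the configurations that produce a diamond. *)
Lemma two_generated_of_free (G : zmodType) (x y : G) :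
  generalized_cyclic_diamond_free G ->
  (exists z : G, join (cyc x) (cyc y) = cyc z) \/
  exists (x' t : G) (N : nat),
    join (cyc x) (cyc y) = join (cyc x') (cyc t) /\
    split_basis x' t (2 ^ N)%N.
Proof.
move=> free.
have [m [n [mn0 e]]] : exists m n : int, (m, n) != (0, 0) /\ comb x y m n = 0.
  apply: contrapT => H.
  have H0 i j : comb x y i j = 0 -> i = 0 /\ j = 0.
    move=> e; have [[-> ->]//|ij] := eqVneq (i, j) (0, 0).
    by case: H; exists i, j.
  apply: (@not_free_disjoint G x y) free.
  - by move=> x0; have [] := H0 1 0; rewrite ?comb10.
  - by move=> x0; have [] := H0 0 1; rewrite ?comb01.
  - by move=> i j /H0[-> ->]; rewrite !mulr0z.
have [x' [t [d [jt d0 td dmin]]]] := reduced_basis mn0 e.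
have d_neq0 : d%:Z != 0 by case: (d) d0.
have [d1|d_neq1] := eqVneq d 1%N.
  left; exists x'; rewrite -jt; apply/seteqP; split; last exact: sub_joinl.
  apply: join_min => //; first exact: gen_subgroup.
  have -> : t = 0 by rewrite -td d1.
  by rewrite cyc0 => _ ->; apply/cycP; exists 0; rewrite mulr0z.
right.
(* t (d / p) has order p, and it is not a multiple of x': such a relation
   would have content at most d / p, against the minimality of d. *)
have div_ord p : (p %| d)%N -> prime p ->
    t *~ (d %/ p)%N *~ p = 0 /\
    forall k, x' *~ k <> t *~ (d %/ p)%N.
  move=> pd pp; rewrite -mulrzA -PoszM divnK //; split=> // k ek.
  have q0 : (0 < d %/ p)%N by rewrite divn_gt0 ?prime_gt0 // dvdn_leq.
  have kl0 : (k, - (d %/ p)%N%:Z) != (0, 0).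
    by rewrite xpair_eqE negb_and oppr_eq0 orbC eqz_nat -lt0n q0.
  have := dmin _ _ kl0; rewrite /comb mulrNz ek subrr => /(_ erefl).
  apply/negP; rewrite -ltnNge /=.
  apply: (@leq_ltn_trans (d %/ p)).
    by rewrite abszN dvdn_leq // dvdn_gcdr.
  by rewrite ltn_Pdiv // prime_gt1.
have xinf k : x' *~ k = 0 -> k = 0.
  move=> xk; apply/eqP/negPn/negP => k0.
  have [o o0 [xo oP]] := exists_order k0 xk.
  have p_pr : prime (pdiv d) by rewrite pdiv_prime // ltn_neqAle eq_sym d_neq1.
  have pd := pdiv_dvd d; set p := pdiv d in p_pr pd.
  have d_o : (d %| o)%N.
    have le_dg : (d <= gcdn o d)%N.
      apply: (dmin o d); first by rewrite xpair_eqE negb_and d_neq0 orbT.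
      by rewrite /comb xo td addr0.
    exact: dvdn_of_leq_gcd le_dg.
  have po := dvdn_trans pd d_o.
  have [tp ndep] := div_ord p pd p_pr.
  (* The elements of order p of the two cyclic groups are independent. *)
  apply: (@not_free_elementary G p (x' *~ (o %/ p)%N) (t *~ (d %/ p)%N)) free => //.
  - by rewrite -mulrzA -PoszM divnK.
  - move=> /oP; rewrite dvdzE /= => /dvdn_leq; rewrite divn_gt0 ?prime_gt0 //.
    move=> /(_ (dvdn_leq o0 po)); apply/negP; rewrite -ltnNge.
    by rewrite ltn_Pdiv // prime_gt1.
  - move=> /cycP[i]; rewrite -mulrzA => /esym; exact: ndep.
have [N dN] : exists N, d = (2 ^ N)%N.
  suff /p_natP[N ->] : 2%N.-nat d by exists N.
  apply/pnatP => // p pp pd; apply/negPn/negP => p2.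
  have [tp ndep] := div_ord p pd pp.
  apply: (@not_free_infinite_odd G p x' (t *~ (d %/ p)%N)) free => //.
    by have [p2'|//] := even_prime pp; rewrite p2' in p2.
  by move=> t0; apply: (ndep 0); rewrite t0 mulr0z.
exists x', t, N; split=> // k l; rewrite -dN; split=> [ekl|[-> dl]]; last first.
  by rewrite /comb mulr0z add0r (mulrz_dvd td).
have k0 : k = 0.
  have /xinf/eqP : x' *~ (k * d%:Z) = 0.
    have := congr1 (fun z => z *~ d) ekl.
    by rewrite combM /comb mul0rz [l * _]mulrC [t *~ _]mulrzA td mul0rz addr0.
  by rewrite mulf_eq0 (negPf d_neq0) orbF => /eqP.
split=> //; have tl : t *~ l = 0 by rewrite -ekl k0 /comb mulr0z add0r.
have tg := mulrz_gcdz tl td.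
have := dmin 0 (gcdz l d).
rewrite xpair_eqE eqxx /= gcdz_eq0 (negPf d_neq0) andbF /comb tg mulr0z addr0.
move=> /(_ isT erefl); rewrite gcd0n => le_dg.
by rewrite dvdzE; exact: dvdn_of_leq_gcd.
Qed.

(** * Finitely generated subgroups *)

Definition torsion (G : zmodType) (t : G) := exists2 k : int, k != 0 & t *~ k = 0.

Lemma torsion_join (G : zmodType) (s t w : G) :
  torsion s -> torsion t -> join (cyc s) (cyc t) w -> torsion w.
Proof.
move=> [k k0 sk] [l l0 tl] /join_cycP[m [n ->]]; exists (k * l).
  by rewrite mulf_neq0.
rewrite combM /comb (mulrz_dvd sk) ?(mulrz_dvd tl) ?addr0//.
  by rewrite mulrA dvdz_mull.
by rewrite mulrCA dvdz_mulr.
Qed.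

Lemma torsion_generator (G : zmodType) (x y : G) :
  generalized_cyclic_diamond_free G ->
  exists x' t : G, join (cyc x) (cyc y) = join (cyc x') (cyc t) /\ torsion t.
Proof.
move=> /(two_generated_of_free x y)[[z ->]|[x' [t [N [-> rel]]]]].
  exists z, 0; split; last by exists 1; rewrite ?mul0rz.
  apply/seteqP; split; first exact: sub_joinl.
  apply: join_min => //; first exact: gen_subgroup.
  by rewrite cyc0 => _ ->; apply/cycP; exists 0; rewrite mulr0z.
exists x', t; split=> //; exists (2 ^ N)%N.
  by rewrite eqz_nat expn_eq0.
have [_ <-] := rel 0 (2 ^ N)%N; first by rewrite /comb mulr0z add0r.
by split=> //; exact: dvdzz.
Qed.

(** A subgroup with a [split_basis] contains elements of infinite order, so
only the cyclic case of [two_generated_of_free] is left. *)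
Lemma torsion_join_cyclic (G : zmodType) (s t : G) :
  generalized_cyclic_diamond_free G -> torsion s -> torsion t ->
  exists z : G, join (cyc s) (cyc t) = cyc z.
Proof.
move=> free ts tt.
have [//|[x' [t' [N [e rel]]]]] := two_generated_of_free s t free.
have [|k k0 xk] := @torsion_join _ s t x' ts tt.
  by rewrite e; apply: (@sub_joinl _ (cyc x')); exact: cyc_id.
have [] := (rel k 0).1; last by move=> kE; rewrite kE in k0.
by rewrite /comb mulr0z addr0.
Qed.

(** The induction keeps the second generator torsion: a new element y is merged
with x into a pair x', t' with t' torsion, and then t' and t into one torsion
element. *)
Lemma finitely_generated_of_free (G : zmodType) (H : set G) :
  generalized_cyclic_diamond_free G -> finitely_generated H ->
  exists x y : G, H = join (cyc x) (cyc y).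
Proof.
move=> free [X /finite_seqP[s ->] ->] {H X}.
suff [x [t [-> _]]] : exists x t : G,
  gen [set` s] = join (cyc x) (cyc t) /\ torsion t by exists x, t.
elim: s => [|y s [x [t [IHs tt]]]].
  exists 0, 0; split; last by exists 1; rewrite ?mul0rz.
  apply/seteqP; split; first by apply: gen_min; [exact: gen_subgroup|].
  have g0 : cyc (0 : G) `<=` gen [set` Nil G].
    by rewrite cyc0 => _ ->; have [] := (subgroupP _).1 (gen_subgroup [set` Nil G]).
  by apply: join_min => //; exact: gen_subgroup.
have [x' [t' [ext tt']]] := torsion_generator y x free.
have [z ez] := torsion_join_cyclic free tt' tt.
exists x', z; split; last first.
  by apply: torsion_join tt' tt _; rewrite ez; exact: cyc_id.
rewrite -ez joinA -ext -joinA -IHs.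
have -> : [set` y :: s] = [set y] `|` [set` s].
  by apply/seteqP; split=> w; rewrite /= in_cons => /predU1P.
rewrite /join /cyc.
by rewrite gen_setU_gen [in RHS]setUC gen_setU_gen setUC.
Qed.

(** * Bases and isomorphisms with Z x Z_d *)

Lemma inZp1_mulrz (n : nat) (k : int) :
  (inZp 1 : 'I_n.+1) *~ k = 0 <-> (n.+1 %| k)%Z.
Proof.
have H m : (inZp 1 : 'I_n.+1) *+ m = inZp m.
  by rewrite Zp_mulrn; apply: val_inj; rewrite /= modnMml mul1n.
have H0 m : (inZp m : 'I_n.+1) = 0 <-> (n.+1 %| m)%N.
  rewrite /dvdn; split=> [/(congr1 val)/= ->//|/eqP m0]; exact: val_inj.
case: k => m; first by rewrite -[_ *~ _]/(_ *+ m) H H0 dvdzE.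
rewrite NegzE mulrNz -[_ *~ _]/(_ *+ m.+1) H dvdzE /=.
by rewrite -H0; split=> [/eqP|->]; rewrite ?oppr_eq0 ?oppr0// => /eqP.
Qed.

(** An isomorphism amounts to the choice of the images of the two standard
generators. *)
Lemma isomorphicP (G : zmodType) (H : set G) (d : nat) : (0 < d)%N ->
  isomorphic (int * Zmod d)%type H <->
  exists x t : G, H = join (cyc x) (cyc t) /\ split_basis x t d.
Proof.
case: d => // n _ /=; split.
  move=> [f f_inj fH]; pose e : 'I_n.+1 := inZp 1.
  exists (f (1, 0)), (f (0, e)).
  have fE m k : comb (f (1, 0)) (f (0, e)) m k = f (m, e *~ k).
    rewrite /comb -!raddfMz -raddfD; congr (f _).
    rewrite [LHS]surjective_pairing !raddfD /= !raddfMz /=.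
    by rewrite mul0rz mul0rz addr0 add0r intz.
  split=> [|m k]; last first.
    rewrite fE -(raddf0 f) -inZp1_mulrz; split=> [/f_inj[-> ->]//|[-> ->]//].
  apply/seteqP; split=> [w|w /join_cycP[m [k ->]]]; rewrite -fH.
    move=> [[m j] _ <-]; apply/join_cycP; exists m, (j : nat).
    rewrite fE; congr (f (_, _)); rewrite -[_ *~ _]/(_ *+ j) Zp_mulrn.
    by apply: val_inj; rewrite /= modnMml mul1n modn_small.
  by rewrite fE; exists (m, e *~ k).
move=> [x [t [-> rel]]].
pose f (u : int * 'I_n.+1) : G := comb x t u.1 (u.2 : nat).
have tn : t *~ n.+1 = 0.
  have [_ <-] := rel 0 n.+1; first by rewrite /comb mulr0z add0r.
  by split=> //; exact: dvdzz.
have tmod k : t *+ (k %% n.+1) = t *+ k.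
  rewrite [in RHS](divn_eq k n.+1) mulrnDr mulnC mulrnA.
  by rewrite -[t *+ n.+1]/(t *~ n.+1) tn mul0rn add0r.
have fD : nmod_morphism f.
  split; first by rewrite /f /comb mulr0z addr0.
  move=> u v; rewrite /f combD /comb /=; congr (_ + _).
  by rewrite -PoszD -[LHS]/(_ *+ _) tmod.
pose fa := GRing.isNmodMorphism.Build _ _ f fD.
pose F : {additive (int * 'I_n.+1)%type -> G} := HB.pack f fa.
exists F.
  move=> [m j] [m' j'] /eqP; rewrite -subr_eq0 => /eqP.
  rewrite combB => /rel[/eqP]; rewrite subr_eq0 => /eqP /= -> dj.
  congr pair; apply: val_inj => /=.
  move: dj; rewrite -eqz_mod_dvd => /eqP; rewrite !modz_nat !modn_small //.
  by case.
apply/seteqP; split=> [_ [u _ <-]|_ /join_cycP[m [k ->]]].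
  by apply/join_cycP; eexists; eexists.
exists (m, inord `|(k %% n.+1)%Z|%N) => //=.
rewrite /f /comb /= inordK.
  rewrite gez0_abs ?modz_ge0 //; congr (_ + _).
  rewrite [in RHS](divz_eq k n.+1) [in RHS]mulrzDr_tmp.
  by rewrite [X in _ = X + _](mulrz_dvd tn) ?add0r // dvdz_mull.
by rewrite -[(_ < _)%N]ltz_nat gez0_abs ?modz_ge0 // ltz_pmod.
Qed.

(** * Excluding diamonds *)

Lemma diamond_symm (G : zmodType) (T A B C D : set G) :
  diamond T A B C D -> diamond T B A C D.
Proof.
move=> [[sT sA sB sC sD] u [jAB jAC jBC] [iAB iAC iBC]]; split=> //.
- have : perm_eq [:: T; A; B; C; D] [:: T; B; A; C; D].
    by rewrite perm_cons (perm_catCA [:: A] [:: B]).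
  by move=> /perm_uniq <-.
- by rewrite joinC.
- by rewrite setIC.
Qed.

Lemma diamond_not_sub (G : zmodType) (T A B C D : set G) :
  diamond T A B C D -> ~ (T `<=` D).
Proof.
move=> [_ u [jAB _ _] [iAB _ _]] TD.
have eTD : T = D.
  apply/seteqP; split=> // w; rewrite -iAB => -[Aw _].
  by rewrite -jAB; exact: (@sub_joinl _ A).
by move: u; rewrite eTD /= !inE eqxx !orbT.
Qed.

(** T/D is the direct sum of any two of the middle quotients, so a generator
of one of them is, modulo another, a multiple of a generator of the third. *)
Lemma diamond_mulrz (G : zmodType) (T D : set G) (x y z : G) (k : int) :
  diamond T (cyc x) (cyc y) (cyc z) D -> D (x *~ k) ->
  forall w, T w -> D (w *~ k).
Proof.
move=> [[_ _ _ _ sD] _ [jxy jxz jyz] [ixy ixz iyz]] Dxk.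
have yk m : cyc y (y *~ m) by apply/cycP; exists m.
have zT : T z by rewrite -jxz; apply: (@sub_joinr _ _ (cyc z)); exact: cyc_id.
have yT : T y by rewrite -jxy; apply: (@sub_joinr _ _ (cyc y)); exact: cyc_id.
have Dy m : D (x *~ k *~ m).
  by apply: subgroup_mulrz.
have step u v : T v -> join (cyc x) (cyc u) = T -> cyc x `&` cyc u = D ->
    cyc u (v *~ k).
  move=> Tv ju iu; move: Tv; rewrite -ju => /join_cycP[m [n ->]].
  rewrite /comb -[k]intz mulrzDl_tmp !intz -!mulrzA [m * k]mulrC [n * k]mulrC.
  apply: (@subgroupD _ (cyc u)); first exact: gen_subgroup.
    by have := Dy m; rewrite -iu mulrzA => -[].
  by apply/cycP; exists (k * n).
have Dyk : D (y *~ k) by rewrite -iyz; split=> //; exact: step yT jxz ixz.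
move=> w; rewrite -jxy => /join_cycP[m [n ->]]; rewrite combM /comb.
rewrite [m * k]mulrC [n * k]mulrC !mulrzA.
by apply: subgroupD => //; apply: subgroup_mulrz.
Qed.

Lemma no_cyclic_diamond_top (G : zmodType) (D : set G) (x y z g : G) :
  ~ diamond (cyc g) (cyc x) (cyc y) (cyc z) D.
Proof.
move=> dia; apply: (diamond_not_sub dia).
have [[_ _ _ _ sD] _ [jxy _ _] [ixy _ _]] := dia.
have [m ex] : exists m, x = g *~ m.
  by apply/cycP; rewrite -jxy; apply: (@sub_joinl _ (cyc x)); exact: cyc_id.
have [n ey] : exists m, y = g *~ m.
  by apply/cycP; rewrite -jxy; apply: (@sub_joinr _ _ (cyc y)); exact: cyc_id.
have exy : x *~ n = y *~ m by rewrite ex ey -!mulrzA mulrC.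
have Dxn : D (x *~ n).
  by rewrite -ixy; split; [|rewrite exy]; apply/cycP; eexists.
have gg : cyc g g by exact: cyc_id.
have Dgn := diamond_mulrz dia Dxn gg.
have Dgm : D (g *~ m) by apply: (diamond_mulrz (diamond_symm dia)) gg; rewrite -exy.
apply: cyc_min => //.
have : join (cyc x) (cyc y) g by rewrite jxy.
move=> /join_cycP[i [j ->]]; rewrite /comb ex ey.
by apply: subgroupD => //; apply: subgroup_mulrz.
Qed.

Lemma dvd2B (m n : int) : (2 %| m - n)%Z = ((2 %| m)%Z == (2 %| n)%Z).
Proof. lia. Qed.

Lemma dvd2M (m n : int) : (2 %| m * n)%Z = (2 %| m)%Z || (2 %| n)%Z.
Proof. by rewrite !dvdzE abszM Euclid_dvdM. Qed.

Lemma split_basis_eq (G : zmodType) (e t : G) (d : nat) (m n k l : int) :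
  split_basis e t d ->
  comb e t m n = comb e t k l <-> m = k /\ (d %| n - l)%Z.
Proof.
move=> rel; split=> [h|[-> h]].
  have [|/eqP] := (rel (m - k) (n - l)).1; first by rewrite -combB h subrr.
  by rewrite subr_eq0 => /eqP.
by apply/eqP; rewrite -subr_eq0 combB subrr; apply/eqP/rel.
Qed.

(** If w were odd, 2^N (a, u) = l (c, w) would force 2^N to divide l, hence c to
divide a; as a and c generate Z, this makes c a unit. *)
Lemma even_of_even (G : zmodType) (e t : G) (N : nat) (a u c w : int) :
  split_basis e t (2 ^ N)%N ->
  join (cyc (comb e t a u)) (cyc (comb e t c w)) e ->
  cyc (comb e t c w) (comb e t a u *~ (2 ^ N)%N) ->
  (2 %| c)%Z -> (2 %| w)%Z.
Proof.
move=> rel /join_cycP[i [j]]; rewrite comb_comb -[X in X = _](comb10 e t).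
move=> /(split_basis_eq _ _ _ _ rel)[e1 _] /cycP[l].
rewrite !combM => /(split_basis_eq _ _ _ _ rel)[eac dl] c2.
apply/negPn/negP => w_odd.
have /dvdzP[q lq] : ((2 ^ N)%N %| l)%Z.
  have cop : coprimez (2 ^ N)%N w.
    rewrite /coprimez /gcdz absz_nat -[_ == 1]/(coprime (2 ^ N) `|w|).
    by apply: coprimeXl; rewrite prime_coprime.
  rewrite -(Gauss_dvdzr _ cop).
  have -> : w * l = u * (2 ^ N)%N - (u * (2 ^ N)%N - w * l) by ring.
  by rewrite rpredB ?dvdz_mull.
have N0 : (2 ^ N)%N%:Z != 0 by rewrite eqz_nat expn_eq0.
have ea : a = c * q.
  by apply: (mulIf N0); rewrite eac lq mulrA.
suff : (2 %| (1 : int)%R)%Z by [].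
by rewrite [X in (_ %| X)%Z]e1 ea -!mulrA -mulrDr dvdz_mulr.
Qed.

(** The matrix that expresses e and t in the two generators is, modulo 2, an
inverse of the matrix of their coordinates. *)
Lemma det_odd (G : zmodType) (e t : G) (N : nat) (a u b v : int) :
  split_basis e t (2 ^ N)%N ->
  (0 < N)%N ->
  join (cyc (comb e t a u)) (cyc (comb e t b v)) e ->
  join (cyc (comb e t a u)) (cyc (comb e t b v)) t ->
  ~~ (2 %| a * v - b * u)%Z.
Proof.
move=> rel N0 /join_cycP[i [j]]; rewrite comb_comb -[X in X = _](comb10 e t).
move=> /(split_basis_eq _ _ _ _ rel)[e1 e2] /join_cycP[k [l]]; rewrite comb_comb.
rewrite -[X in X = _](comb01 e t) => /(split_basis_eq _ _ _ _ rel)[f1 f2].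
have d2 (n : int) : ((2 ^ N)%N %| n)%Z -> (2 %| n)%Z.
  by move=> h; apply: dvdz_trans h; rewrite dvdzE /= dvdn_exp.
have {e2}/dvdzP[q eq] := d2 _ e2; have {f2}/dvdzP[r er] := d2 _ f2.
apply/negP => /dvdzP[s es].
suff : (2 %| (1 : int)%R)%Z by [].
(* Multiplicativity of the determinant, with the error terms of the product
   matrix: its entries are 1, 0, and, modulo 2, again 0 and 1. *)
rewrite [X in (_ %| X)%Z](_ : _ = (a * v - b * u) * (i * l - j * k)
   + (1 - (u * k + v * l)) * (a * i + b * j)
   + (1 - (a * i + b * j)) + (a * k + b * l) * (u * i + v * j)); last by ring.
by rewrite es er -e1 -f1 subrr mul0r !addr0 mulr1 -mulrAC -mulrDl dvdz_mull.
Qed.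

(** If 2 divides the first coordinate of a generator then it divides the second
one ([even_of_even]), which excludes (0, 1) mod 2; and no three vectors of
F_2^2 other than (0, 1) are pairwise independent ([det_odd]). *)
Lemma no_split_diamond_top (G : zmodType) (e t : G) (N : nat)
    (D : set G) (x y z : G) :
  split_basis e t (2 ^ N)%N ->
  ~ diamond (join (cyc e) (cyc t)) (cyc x) (cyc y) (cyc z) D.
Proof.
move=> rel dia.
have [[_ _ _ _ sD] _ [jxy jxz jyz] [ixy ixz iyz]] := dia.
set T := join (cyc e) (cyc t) in dia jxy jxz jyz.
have Te : T e by apply: (@sub_joinl _ (cyc e)); exact: cyc_id.
have Tt : T t by apply: (@sub_joinr _ _ (cyc t)); exact: cyc_id.
have Tx : T x by rewrite -jxy; apply: (@sub_joinl _ (cyc x)); exact: cyc_id.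
have Ty : T y by rewrite -jxy; apply: (@sub_joinr _ _ (cyc y)); exact: cyc_id.
have Tz : T z by rewrite -jxz; apply: (@sub_joinr _ _ (cyc z)); exact: cyc_id.
have /join_cycP[a [u ex]] := Tx.
have /join_cycP[b [v ey]] := Ty.
have /join_cycP[c [w ez]] := Tz.
pose q := (2 ^ N)%N%:Z.
have DT m : T m -> D (m *~ q).
  have exy : x *~ (b * q) = y *~ (a * q).
    rewrite ex ey !combM; apply/(split_basis_eq _ _ _ _ rel); split; first by ring.
    by rewrite rpredB // !mulrA dvdz_mull.
  have Dx : D (x *~ (b * q)).
    by rewrite -ixy; split; [|rewrite exy]; apply/cycP; eexists.
  have Dy : D (y *~ (a * q)) by rewrite -exy.
  have : join (cyc x) (cyc y) e by rewrite jxy.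
  move=> /join_cycP[i [j]]; rewrite ex ey comb_comb -[X in X = _](comb10 e t).
  move=> /(split_basis_eq _ _ _ _ rel)[e1 _] Tm.
  have -> : q = i * (a * q) + j * (b * q) by rewrite -[LHS]mul1r e1; ring.
  rewrite mulrz_lin; apply: subgroupD => //; apply: subgroup_mulrz => //.
    exact: (diamond_mulrz (diamond_symm dia)) Tm.
  exact: (diamond_mulrz dia) Tm.
(* 2^0 = 1 would give T = D. *)
have [N0|N0] := posnP N.
  by apply: (diamond_not_sub dia) => m /DT; rewrite /q N0 expn0 mulr1z.
have cz := even_of_even (a := a) (u := u) (c := c) (w := w) rel.
rewrite -ex -ez jxz in cz.
have cy := even_of_even (a := a) (u := u) (c := b) (w := v) rel.
rewrite -ex -ey jxy in cy.
have cx := even_of_even (a := b) (u := v) (c := a) (w := u) rel.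
rewrite -ex -ey joinC jxy in cx.
have dxy := det_odd (a := a) (u := u) (b := b) (v := v) rel N0.
rewrite -ex -ey jxy in dxy.
have dxz := det_odd (a := a) (u := u) (b := c) (v := w) rel N0.
rewrite -ex -ez jxz in dxz.
have dyz := det_odd (a := b) (u := v) (b := c) (v := w) rel N0.
rewrite -ey -ez jyz in dyz.
have {cz} := cz Te; have {cy} := cy Te; have {cx} := cx Te.
have /= := DT _ Tx; rewrite -/q; have := DT _ Ty.
rewrite -{1}ixy -{1}ixz => -[Dyx _] [_ Dxz].
have [_ Dxy] : (cyc x `&` cyc y) (x *~ q) by rewrite ixy; exact: DT.
move=> /(_ Dyx) cx /(_ Dxy) cy /(_ Dxz) cz.
move: (dxy Te Tt) (dxz Te Tt) (dyz Te Tt) cx cy cz.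
rewrite !dvd2B !dvd2M.
move=> h1 h2 h3 /implyP h4 /implyP h5 /implyP h6.
by move: h1 h2 h3 h4 h5 h6; do 6!case: (2 %| _)%Z.
Qed.

Theorem theorem3p8 (G : zmodType) :
  generalized_cyclic_diamond_free G <->
  forall H : set G, subgroup H -> finitely_generated H ->
    cyclic_subgroup H \/
    exists N : nat, isomorphic (int * Zmod (2 ^ N)%N)%type H.
Proof.
have pos2 N : (0 < 2 ^ N)%N by rewrite expn_gt0.
split=> [free H _ /(finitely_generated_of_free free)[x [y ->]]|fgH].
  have [[z ->]|[x' [t [N [-> rel]]]]] := two_generated_of_free x y free.
    by left; exists z.
  by right; exists N; apply/(isomorphicP _ (pos2 N)); exists x', t.
move=> [H [x [y [z [a dia]]]]].
have [[sH _ _ _ _] _ [jxy _ _] _] := dia.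
have fg : finitely_generated H.
  exists [set x; y]; first exact: finite_set2.
  by rewrite -jxy /join /cyc gen_setU_gen setUC gen_setU_gen setUC.
have [[g eg]|[N /(isomorphicP _ (pos2 N))[e [t [eH rel]]]]] := fgH H sH fg.
  by rewrite eg in dia; exact: no_cyclic_diamond_top dia.
by rewrite eH in dia; exact: (no_split_diamond_top rel) dia.
Qed.
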